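(* There exists $M>0$ such that for all $m\in\mathbb{R}$ and $v>0$ with $|m/\sqrt{v}|>M$, the normal distribution $N(m,v)$ with mean $m$ and variance $v$ is not Boolean selfdecomposable.
   Context: For a Borel probability measure $\mu$ on $\mathbb{R}$ put $G_\mu(z)=\int_{\mathbb{R}}\frac{1}{z-x}\,\mu(dx)$, $F_\mu(z)=1/G_\mu(z)$ and $K_\mu(z)=z-F_\mu(z)$ for $z$ in the open upper half-plane $\mathbb{C}^+$. For any two probability measures $\mu,\nu$ on $\mathbb{R}$, the Boolean convolution $\mu\uplus\nu$ is the unique probability measure on $\mathbb{R}$ with $K_{\mu\uplus\nu}=K_\mu+K_\nu$ on $\mathbb{C}^+$. For $c\in\mathbb{R}$, $D_c(\mu)$ is the push-forward of $\mu$ by $x\mapsto cx$. A probability measure $\mu$ on $\mathbb{R}$ is Boolean selfdecomposable if for every $c\in(0,1)$ there is a probability measure $\mu_c$ on $\mathbb{R}$ with $\mu=D_c(\mu)\uplus\mu_c$. *)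

(* Defs.v *)
From HB Require Import structures.
From mathcomp Require Import all_boot all_order all_algebra.
From mathcomp Require Import all_classical all_reals all_analysis.
From mathcomp.real_closed Require Import complex.
Import Order.TTheory GRing.Theory Num.Theory.
Import numFieldNormedType.Exports.

Set Implicit Arguments.
Unset Strict Implicit.
Unset Printing Implicit Defensive.

Local Open Scope ring_scope.
Local Open Scope complex_scope.
Local Open Scope classical_set_scope.

Definition borel_probability (R : realType) : Type :=
  probability (measurableTypeR R) R.

Definition upper_half_plane {R : realType} : set R[i] :=
  [set z | 0 < complex.Im z].

Section cauchy_transform.
Context {R : realType}.
Implicit Types (mu nu rho : borel_probability R) (z : R[i]) (c : R).

(* No integral of complex-valued functions is available, hence the integration
   of the real and imaginary parts; for z in the upper half-plane the integrand
   is bounded by 1 / Im z, so that both parts are integrable. *)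
Definition cauchy_transform mu z : R[i] :=
  (\int[mu]_x complex.Re (1 / (z - x%:C))) +i*
  (\int[mu]_x complex.Im (1 / (z - x%:C))).

Definition F_transform mu z : R[i] := 1 / cauchy_transform mu z.

Definition K_transform mu z : R[i] := z - F_transform mu z.

(* rho = mu \uplus nu. The Boolean convolution is given as a relation: it is the
   probability measure determined by this identity of K-transforms. *)
Definition is_boolean_convolution mu nu rho : Prop :=
  forall z, z \in upper_half_plane ->
    K_transform rho z = K_transform mu z + K_transform nu z.

Definition scaling c (x : measurableTypeR R) : measurableTypeR R := c * x.

Lemma measurable_scaling c : measurable_fun setT (scaling c).
Proof. exact: measurable_realfun.mulrl_measurable. Qed.

HB.instance Definition _ c :=
  isMeasurableFun.Build _ _ _ _ (scaling c) (measurable_scaling c).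

Definition dilation c mu : borel_probability R := distribution mu (scaling c).

Definition boolean_selfdecomposable mu : Prop :=
  forall c, 0 < c < 1 ->
    exists mu_c : borel_probability R,
      is_boolean_convolution (dilation c mu) mu_c mu.

End cauchy_transform.

(* normal_prob takes the standard deviation as second argument. *)
Definition normal_law {R : realType} (m v : R) : borel_probability R :=
  normal_prob m (Num.sqrt v).

(* Main.v *)
Require Import Defs.
From HB Require Import structures.
From mathcomp Require Import all_boot all_order all_algebra.
From mathcomp Require Import all_classical all_reals all_analysis.
From mathcomp.real_closed Require Import complex.
From mathcomp Require Import measurable_realfun.
From mathcomp Require Import ring lra.
Import Order.TTheory GRing.Theory Num.Theory.
Import numFieldNormedType.Exports.

Set Implicit Arguments.
Unset Strict Implicit.
Unset Printing Implicit Defensive.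

Local Open Scope classical_set_scope.
Local Open Scope ring_scope.

(** Write [G = Q - i b N] for the Cauchy transform of [mu] at [z = a + i b],
    where [N] is the integral of [|1 / (z - x)|^2] and [Q] that of
    [Re (1 / (z - x))].  Then [Im (K z) = b (1 - V z)] with
    [V = N / (Q^2 + b^2 N^2)], the ratio of the mean of [|1 / (z - x)|^2] to the
    square modulus of the mean of [1 / (z - x)].  By Cauchy-Schwarz [V >= 1]
    ([dispersion_ge1]), and since [V] follows affine changes of variable, the
    identity [K_mu = K_(D_c mu) + K_(mu_c)] at [c z] forces [V z <= V (c z)] for
    all [z] and all [0 < c < 1] ([boolean_selfdecomposable_dispersion]): along a
    ray, [V] can only grow towards the origin.

    For [N(m, v)] with [s = sqrt v] the value of [V] at [m + s a + i s b] is that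
    of the standard normal law at [a + i b].  If [|m| / s] is large, a factor [c]
    close to [1] already moves the point above the mean [m] to one whose abscissa
    is a prescribed number [A] of standard deviations away from [m].  So it
    suffices that the standard normal law satisfies [V (+- A + i) < V (i b)] for
    some [A] and all [0 < b <= 2] ([dispersion_std_normal_drop]).  By symmetry
    [V (i b)] is nonincreasing in [b] and greater than [1], hence bounded away
    from [1] on [0 < b <= 2].  On the other side [V (a + i) - 1] is at most four
    times the mean of [x^2 / |z - x|^2] when the latter is at most [1 / 4]
    ([dispersion_le]), and this mean is [O(a^-2)] because the normal law has
    moments of order four. *)

(** * Affine changes of variable and normal laws *)

Section affine.
Context {R : realType}.
Notation lambda := (@lebesgue_measure R).

Definition affine (m s : R) (x : measurableTypeR R) : measurableTypeR R :=
  m + s * x.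

Lemma measurable_affine m s : measurable_fun setT (affine m s).
Proof.
apply: measurable_funD => //; exact: measurable_realfun.mulrl_measurable.
Qed.

HB.instance Definition _ m s :=
  isMeasurableFun.Build _ _ _ _ (affine m s) (measurable_affine m s).

(** Both sides are measures in [A], so half-open intervals suffice. *)
Lemma lebesgue_measure_affine (m s : R) (A : set R) : s != 0 -> measurable A ->
  lambda A = (`|s|%:E * lambda (affine m s @^-1` A))%E.
Proof.
move=> s0 mA.
have as0 : 0 <= `|s| by [].
have uniq := @lebesgue_measure_unique R (mscale (NngNum as0)
  (@measure_function_pushforward__canonical__measure_function_Measure
    _ _ _ _ _ lambda (affine m s) (measurable_affine m s))).
apply: uniq => //= _ [[a b]] _ <-.
rewrite /mscale/= /pushforward.
have : (s < 0) || (0 < s) by rewrite -neq_lt.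
case/orP => sp.
- have -> : affine m s @^-1` `]a, b] = `[((b - m) / s), ((a - m) / s)[%classic.
    apply/seteqP; split => x; rewrite /affine /= !in_itv /=;
      by rewrite ler_ndivrMr// ltr_ndivlMr// lerBrDl ltrBlDl [x * s]mulrC andbC.
  rewrite !lebesgue_measure_itv/= !lte_fin ltr_nM2r ?invr_lt0// ltrD2r.
  case: ifP => ab; last by rewrite mule0.
  rewrite -!EFinD -EFinM ltr0_norm//; congr (_%:E); field; by rewrite lt_eqF.
- have -> : affine m s @^-1` `]a, b] = `]((a - m) / s), ((b - m) / s)]%classic.
    apply/seteqP; split => x; rewrite /affine /= !in_itv /=;
      by rewrite ler_pdivlMr// ltr_pdivrMr// lerBrDl ltrBlDl [x * s]mulrC.
  rewrite !lebesgue_measure_itv/= !lte_fin ltr_pM2r ?invr_gt0// ltrD2r.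
  case: ifP => ab; last by rewrite mule0.
  rewrite -!EFinD -EFinM gtr0_norm//; congr (_%:E); field; by rewrite gt_eqF.
Qed.

Lemma ge0_integral_lebesgue_affine (m s : R) (A : set R) (f : R -> \bar R) :
  s != 0 -> measurable A -> measurable_fun A f ->
  {in A, forall x, (0 <= f x)%E} ->
  (\int[lambda]_(x in A) f x =
   `|s|%:E * \int[lambda]_(x in affine m s @^-1` A) f (affine m s x))%E.
Proof.
move=> s0 mA mf f0.
have as0 : 0 <= `|s| by [].
rewrite -(ge0_integral_pushforward (measurable_affine m s) lambda mA mf f0).
rewrite -(@ge0_integral_mscale _ _ _ _ _ _ (NngNum as0))//; last first.
  by move=> x Ax; apply: f0; rewrite inE.
apply: eq_measure_integral => B mB BA.
by rewrite /= (lebesgue_measure_affine m s0).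
Qed.

(** This holds for negative [s] too, hence contains the symmetry of the standard
    normal law. *)
Lemma normal_prob_affine (m s : R) (A : set R) : s != 0 -> measurable A ->
  normal_prob m s A = normal_prob 0 1 (affine m s @^-1` A).
Proof.
move=> s0 mA; rewrite /normal_prob.
rewrite (ge0_integral_lebesgue_affine m s0)//; last 2 first.
- by apply/measurable_funTS/measurableT_comp => //; exact: measurable_normal_pdf.
- by move=> x _; rewrite lee_fin normal_pdf_ge0.
have mpA : measurable (affine m s @^-1` A).
  by rewrite -[X in measurable X]setTI; exact: measurable_affine.
rewrite -ge0_integralZl//.
- apply: eq_integral => x _; rewrite !normal_pdfE ?oner_eq0//; rewrite -EFinM.
  congr (_%:E); rewrite /normal_peak /normal_fun mulrA; congr (_ * expR _).
    rewrite -!mulrnAr sqrtrM ?sqr_ge0// sqrtr_sqr expr1n mul1r.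
    by rewrite invfM mulrA mulfV ?mul1r// normr_eq0.
  by rewrite /affine; field.
- apply/measurable_funTS/measurableT_comp => //.
  exact: measurableT_comp (measurable_normal_pdf m s) (measurable_affine m s).
- by move=> x _; rewrite lee_fin normal_pdf_ge0.
Qed.

(** The density of the normal law is its Radon-Nikodym derivative, by uniqueness
    of the latter up to a null set. *)
Lemma integral_normal_prob (m s : R) (f : R -> \bar R) :
  (normal_prob m s).-integrable setT f ->
  (\int[normal_prob m s]_x f x =
   \int[lambda]_x (f x * (normal_pdf m s x)%:E))%E.
Proof.
move=> fi; have mf := measurable_int _ fi.
rewrite -(Radon_Nikodym_change_of_variables (normal_prob_dominates m s))//=.
apply: ae_eq_integral => //.
- apply: emeasurable_funM => //; apply: (measurable_int lambda).
  by apply: Radon_Nikodym_integrable; exact: normal_prob_dominates.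
- apply: emeasurable_funM => //=; apply/measurableT_comp => //=.
  exact: measurable_normal_pdf.
- apply: ae_eqe_mul2l => /=.
  rewrite Radon_NikodymE//=; first exact: normal_prob_dominates.
  move=> dom; case: cid => /= h [h1 h2 h3].
  apply: integral_ae_eq => //=.
  + by apply/measurableT_comp => //; exact: measurable_normal_pdf.
  + by move=> E _ mE; rewrite -h3.
Qed.

End affine.

(** * Dispersion of the resolvent *)

Section dispersion.
Context {R : realType}.
Implicit Types (mu nu : borel_probability R) (a b x m s : R).

(** [|1 / (z - x)|^2] at [z = a + i b]. *)
Definition resolvent_norm2 a b x : R := ((a - x) ^+ 2 + b ^+ 2)^-1.

(** The imaginary part of the Cauchy transform is [- b] times this number. *)
Definition cauchy_norm2 mu a b : R := \int[mu]_x resolvent_norm2 a b x.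

Definition cauchy_re mu a b : R :=
  \int[mu]_x ((a - x) * resolvent_norm2 a b x).

(** The mean of [|1 / (z - x)|^2] divided by the square modulus of the mean of
    [1 / (z - x)]: one plus the squared coefficient of variation of the
    resolvent. *)
Definition dispersion mu a b : R :=
  cauchy_norm2 mu a b /
  (cauchy_re mu a b ^+ 2 + (b * cauchy_norm2 mu a b) ^+ 2).

Lemma resolvent_den_gt0 a b x : b != 0 -> 0 < (a - x) ^+ 2 + b ^+ 2.
Proof. by move=> b0; rewrite ltr_wpDl ?sqr_ge0// exprn_even_gt0. Qed.

Lemma resolvent_norm2_gt0 a b x : b != 0 -> 0 < resolvent_norm2 a b x.
Proof. by move=> b0; rewrite invr_gt0 resolvent_den_gt0. Qed.

Lemma resolvent_norm2_ge0 a b x : 0 <= resolvent_norm2 a b x.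
Proof. by rewrite invr_ge0 addr_ge0 ?sqr_ge0. Qed.

Lemma measurable_resolvent_norm2 a b : b != 0 ->
  measurable_fun [set: measurableTypeR R] (resolvent_norm2 a b).
Proof.
move=> b0; apply: continuous_measurable_fun => x; apply: cvgV.
  by rewrite gt_eqF// resolvent_den_gt0.
apply: cvgD; last exact: cvg_cst.
apply: (cvg_comp (fun y => a - y) (fun y => y ^+ 2)).
  by apply: (@cvgB _ R^o) => //; [exact: cvg_cst|exact: cvg_id].
exact: sqr_continuous.
Qed.

Lemma measurable_resolvent_re a b : b != 0 ->
  measurable_fun [set: measurableTypeR R]
    (fun x => (a - x) * resolvent_norm2 a b x).
Proof.
move=> b0; apply: measurable_funM; last exact: measurable_resolvent_norm2.
exact: measurable_funB.
Qed.

Lemma prob_bounded_integrable mu (f : measurableTypeR R -> R) C :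
  measurable_fun setT f -> (forall x, `|f x| <= C) ->
  mu.-integrable setT (EFin \o f).
Proof.
move=> mf fC; apply: measurable_bounded_integrable => //.
  by rewrite [X in (X < _)%E](_ : _ = 1%E) ?ltry//; exact: probability_setT.
exists C; split; first exact: num_real.
by move=> M CM x _; exact: le_trans (fC x) (ltW CM).
Qed.

Lemma integrable_resolvent_norm2 mu a b : b != 0 ->
  mu.-integrable setT (EFin \o resolvent_norm2 a b).
Proof.
move=> b0; apply: (@prob_bounded_integrable _ _ (b ^+ 2)^-1).
  exact: measurable_resolvent_norm2.
move=> x; rewrite gtr0_norm ?resolvent_norm2_gt0//.
rewrite /resolvent_norm2 lef_pV2 ?posrE ?resolvent_den_gt0 ?exprn_even_gt0//.
by rewrite lerDr sqr_ge0.
Qed.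

Lemma integrable_resolvent_re mu a b : b != 0 ->
  mu.-integrable setT (EFin \o (fun x => (a - x) * resolvent_norm2 a b x)).
Proof.
move=> b0; apply: (@prob_bounded_integrable _ _ (1 + (b ^+ 2)^-1)).
  exact: measurable_resolvent_re.
move=> x; rewrite normrM.
rewrite [`|resolvent_norm2 _ _ _|]gtr0_norm ?resolvent_norm2_gt0//.
rewrite ler_pdivrMr ?resolvent_den_gt0//.
have b2 : 0 < b ^+ 2 by rewrite exprn_even_gt0.
have bV : 0 < (b ^+ 2)^-1 by rewrite invr_gt0.
have bb : (b ^+ 2)^-1 * b ^+ 2 = 1 by rewrite mulVf// gt_eqF.
rewrite -[(a - x) ^+ 2]real_normK ?num_real//; set t := `|a - x|.
rewrite mulrDl mul1r mulrDr bb.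
have : 0 <= (b ^+ 2)^-1 * t ^+ 2 by rewrite mulr_ge0 ?sqr_ge0 ?ltW.
have : 0 <= (t - 1) ^+ 2 by exact: sqr_ge0.
have : 0 <= t by exact: normr_ge0.
nra.
Qed.

(** The functions of [x] whose means enter the bounds on the dispersion, such as
    [x^2 |1 / (z - x)|^2], are combinations of the constant [1], [|1 / (z - x)|^2] and [Re (1 / (z - x))].
    Thus inequalities between integrals come from pointwise sums of squares. *)
Lemma integral_resolvent_comb mu a b u v w : b != 0 ->
  mu.-integrable setT (EFin \o (fun x =>
    u + v * resolvent_norm2 a b x + w * ((a - x) * resolvent_norm2 a b x))) /\
  \int[mu]_x (u + v * resolvent_norm2 a b x +
    w * ((a - x) * resolvent_norm2 a b x)) =
  u + v * cauchy_norm2 mu a b + w * cauchy_re mu a b.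
Proof.
move=> b0.
have iu : mu.-integrable setT (EFin \o (fun=> u)).
  by apply: (@prob_bounded_integrable _ _ `|u|).
have iN := integrable_resolvent_norm2 mu a b0.
have iQ := integrable_resolvent_re mu a b0.
have ivN : mu.-integrable setT (EFin \o (fun x => v * resolvent_norm2 a b x)).
  exact: (integrableZl measurableT v iN).
have iwQ : mu.-integrable setT
    (EFin \o (fun x => w * ((a - x) * resolvent_norm2 a b x))).
  exact: (integrableZl measurableT w iQ).
have iuN : mu.-integrable setT
    (EFin \o (fun x => u + v * resolvent_norm2 a b x)).
  exact: (integrableD measurableT iu ivN).
split; first exact: (integrableD measurableT iuN iwQ).
rewrite RintegralD// RintegralD// !RintegralZl// Rintegral_cst//.
by rewrite [X in fine X](_ : _ = 1%E) ?mulr1//; exact: probability_setT.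
Qed.

Lemma resolvent_comb_ge0 mu a b u v w : b != 0 ->
  (forall x, 0 <= u + v * resolvent_norm2 a b x +
    w * ((a - x) * resolvent_norm2 a b x)) ->
  0 <= u + v * cauchy_norm2 mu a b + w * cauchy_re mu a b.
Proof.
move=> b0 h; have [_ <-] := integral_resolvent_comb mu a u v w b0.
exact: Rintegral_ge0.
Qed.

Lemma Rintegral_gt0 mu (f : measurableTypeR R -> R) :
  mu.-integrable setT (EFin \o f) -> (forall x, 0 <= f x) ->
  mu.-negligible [set x | f x = 0] -> 0 < \int[mu]_x f x.
Proof.
move=> fi f0 nf; rewrite lt_neqAle Rintegral_ge0// andbT eq_sym.
apply/negP => /eqP I0.
have mf : measurable_fun setT (EFin \o f) := measurable_int _ fi.
have aI0 : (\int[mu]_x `|(EFin \o f) x| = 0)%E.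
  under eq_integral do rewrite /= ger0_norm//.
  rewrite -[LHS]fineK; first by rewrite -/(Rintegral _ _ _) I0.
  exact: integrable_fin_num.
have /(ae_eq_integral_abs mu measurableT mf) aef := aI0.
have := negligibleU nf aef; rewrite (_ : _ `|` _ = setT); last first.
  apply/seteqP; split => // x _ /=.
  by have [->|fx] := EM (f x = 0); [left|right => /(_ I) []].
rewrite negligibleP// => /eqP.
by rewrite [X in X == _](_ : _ = 1%E) ?onee_eq0//; exact: probability_setT.
Qed.

Lemma cauchy_norm2_gt0 mu a b : b != 0 -> 0 < cauchy_norm2 mu a b.
Proof.
move=> b0; apply: Rintegral_gt0; first exact: integrable_resolvent_norm2.
  by move=> x; exact: resolvent_norm2_ge0.
rewrite (_ : [set _ | _] = set0); first exact: negligible_set0.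
by apply/seteqP; split => // x /= /eqP; rewrite gt_eqF// resolvent_norm2_gt0.
Qed.

Lemma cauchy_sqr_norm_gt0 mu a b : b != 0 ->
  0 < cauchy_re mu a b ^+ 2 + (b * cauchy_norm2 mu a b) ^+ 2.
Proof.
move=> b0; rewrite ltr_wpDl ?sqr_ge0// exprn_even_gt0//= mulf_neq0//.
by rewrite gt_eqF// cauchy_norm2_gt0.
Qed.

(** Cauchy-Schwarz: the variance of the resolvent, that is the integral of
    [|1 / (z - x) - G|^2], is nonnegative. *)
Lemma dispersion_ge1 mu a b : b != 0 -> 1 <= dispersion mu a b.
Proof.
move=> b0; rewrite /dispersion ler_pdivlMr ?cauchy_sqr_norm_gt0// mul1r.
set N := cauchy_norm2 mu a b; set Q := cauchy_re mu a b.
have : 0 <= (Q ^+ 2 + (b * N) ^+ 2) + (1 - 2 * b ^+ 2 * N) * N +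
    (- 2 * Q) * Q.
  apply: resolvent_comb_ge0 => // x.
  have : resolvent_norm2 a b x * ((a - x) ^+ 2 + b ^+ 2) = 1.
    by rewrite mulVf// gt_eqF// resolvent_den_gt0.
  set p := resolvent_norm2 a b x => pE.
  rewrite (_ : _ + _ = ((a - x) * p - Q) ^+ 2 + (b * p - b * N) ^+ 2).
    by rewrite addr_ge0 ?sqr_ge0.
  transitivity (Q ^+ 2 + (b * N) ^+ 2 +
    (p * (p * ((a - x) ^+ 2 + b ^+ 2)) - 2 * b ^+ 2 * N * p) -
    2 * Q * ((a - x) * p)); last by ring.
  by rewrite pE; ring.
nra.
Qed.

(** With [g = 1 / (z - x)] one has [z g = 1 + x g].  Hence [z g] has the variance
    of [x g], which is at most [e], while the mean of [z g] has real part
    [1 + P] with [P] the mean of [Re (x g)]; pointwise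
    [1 / 4 + Re (x g) + |x g|^2 >= 0], so that [1 + P >= 3 / 4 - e >= 1 / 2]. *)
Lemma dispersion_le mu a b (e := \int[mu]_x (x ^+ 2 * resolvent_norm2 a b x)) :
  b != 0 -> e <= 1 / 4 -> dispersion mu a b <= 1 + 4 * e.
Proof.
move=> b0 e4; have z0 : 0 < a ^+ 2 + b ^+ 2.
  by rewrite ltr_wpDl ?sqr_ge0// exprn_even_gt0.
have rE x : resolvent_norm2 a b x * ((a - x) ^+ 2 + b ^+ 2) = 1.
  by rewrite mulVf// gt_eqF// resolvent_den_gt0.
set N := cauchy_norm2 mu a b; set Q := cauchy_re mu a b.
have eE : e = 1 + (a ^+ 2 - b ^+ 2) * N - 2 * a * Q.
  rewrite -[- (2 * a * Q)]mulNr.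
  have [_ <-] :=
    integral_resolvent_comb mu a 1 (a ^+ 2 - b ^+ 2) (- (2 * a)) b0.
  apply: eq_Rintegral => x _; have := rE x.
  set p := resolvent_norm2 a b x => pE.
  transitivity (p * ((a - x) ^+ 2 + b ^+ 2) - b ^+ 2 * p + a ^+ 2 * p -
    2 * a * ((a - x) * p)); last by rewrite pE; ring.
  by ring.
have P2 : 0 <= (1 / 4 + e) + (a * Q + b ^+ 2 * N - 1).
  rewrite eE.
  suff : 0 <= 1 / 4 + a ^+ 2 * N + (- a) * Q by nra.
  apply: resolvent_comb_ge0 => // x; have := rE x.
  set p := resolvent_norm2 a b x => pE.
  (* the integrand is the square modulus of [1 / 2 - a g] *)
  rewrite (_ : _ + _ = (1 / 2 - a * (a - x) * p) ^+ 2 + (a * b * p) ^+ 2).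
    by rewrite addr_ge0 ?sqr_ge0.
  transitivity (1 / 4 + a ^+ 2 * p * (p * ((a - x) ^+ 2 + b ^+ 2)) -
    a * ((a - x) * p)); last by field.
  by rewrite pE; ring.
rewrite /dispersion -/N -/Q ler_pdivrMr ?cauchy_sqr_norm_gt0//.
have e0 : 0 <= e.
  apply: Rintegral_ge0 => x _.
  by rewrite mulr_ge0 ?sqr_ge0 ?resolvent_norm2_ge0.
rewrite -(ler_pM2l z0).
set P := a * Q + b ^+ 2 * N - 1 in P2.
have zG : (a ^+ 2 + b ^+ 2) * (Q ^+ 2 + (b * N) ^+ 2) =
    (1 + P) ^+ 2 + b ^+ 2 * (Q - a * N) ^+ 2.
  by rewrite /P; ring.
have zN : (a ^+ 2 + b ^+ 2) * N = 1 + 2 * P + e by rewrite eE /P; ring.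
rewrite mulrCA zG zN.
have : 0 <= b ^+ 2 * (Q - a * N) ^+ 2 by rewrite mulr_ge0 ?sqr_ge0.
move: (b ^+ 2 * _) => w w0.
have : 0 <= P ^+ 2 by exact: sqr_ge0.
have : 0 <= e * (P + 1 / 2) by rewrite mulr_ge0//; lra.
have : 0 <= e * (P + 1 / 2) ^+ 2 by rewrite mulr_ge0// sqr_ge0.
have : 0 <= e * w by rewrite mulr_ge0.
nra.
Qed.

End dispersion.

(** * Dispersion along rays for Boolean selfdecomposable laws *)

Section boolean.
Context {R : realType}.
Implicit Types (mu nu : borel_probability R) (a b x m s : R).
Local Open Scope complex_scope.

Lemma cauchy_transformE mu a b : b != 0 ->
  cauchy_transform mu (a +i* b) =
  cauchy_re mu a b +i* (- (b * cauchy_norm2 mu a b)).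
Proof.
move=> b0.
have zx x :
    complex.Re (1 / ((a +i* b) - x%:C)) = (a - x) * resolvent_norm2 a b x /\
    complex.Im (1 / ((a +i* b) - x%:C)) = - b * resolvent_norm2 a b x.
  by rewrite mul1r /= subr0 mulNr.
rewrite /cauchy_transform; congr (_ +i* _).
  by apply: eq_Rintegral => x _; exact: (zx x).1.
rewrite -mulNr -RintegralZl//; last exact: integrable_resolvent_norm2.
by apply: eq_Rintegral => x _; exact: (zx x).2.
Qed.

Lemma Im_K_transform mu a b : b != 0 ->
  complex.Im (K_transform mu (a +i* b)) = b * (1 - dispersion mu a b).
Proof.
move=> b0; rewrite /K_transform /F_transform cauchy_transformE// mul1r /=.
rewrite /dispersion sqrrN opprK.
by rewrite mulrBr mulr1 mulNr mulrA.
Qed.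

(** The resolvent of [m + s x] at [m + s z] is [s^-1] times that of [x] at [z].
    As [s] may be negative, this also gives the parity of the Cauchy transform of
    a symmetric law. *)
Lemma cauchy_affine mu nu m s a b : s != 0 -> b != 0 ->
  (forall A, measurable A -> nu A = mu (affine m s @^-1` A)) ->
  cauchy_norm2 nu (m + s * a) (s * b) = s ^- 2 * cauchy_norm2 mu a b /\
  cauchy_re nu (m + s * a) (s * b) = s^-1 * cauchy_re mu a b.
Proof.
move=> s0 b0 numu.
have sb0 : s * b != 0 by rewrite mulf_neq0.
have nE (f g : measurableTypeR R -> R) (r : R) :
    nu.-integrable setT (EFin \o f) -> mu.-integrable setT (EFin \o g) ->
    (forall x, f (affine m s x) = r * g x) ->
    \int[nu]_x f x = r * \int[mu]_x g x.
  move=> fi gi fg; rewrite -RintegralZl//; congr fine.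
  have mf : measurable_fun setT (EFin \o f) := measurable_int _ fi.
  transitivity (\int[distribution mu (affine m s)]_x (EFin \o f) x)%E.
    by apply: eq_measure_integral => A mA _; exact: numu.
  rewrite integral_distribution//.
    by apply: eq_integral => x _ /=; rewrite fg.
  rewrite (_ : _ \o _ = EFin \o (fun x => r * g x)); last first.
    by apply/funext => x /=; rewrite fg.
  exact: (integrableZl measurableT r gi).
have rnE x : resolvent_norm2 (m + s * a) (s * b) (affine m s x) =
    s ^- 2 * resolvent_norm2 a b x.
  rewrite /resolvent_norm2 -invfM; congr (_^-1).
  by rewrite /affine; ring.
split; apply: nE; rewrite ?rnE //.
- exact: integrable_resolvent_norm2.
- exact: integrable_resolvent_norm2.
- exact: integrable_resolvent_re.
- exact: integrable_resolvent_re.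
- by move=> x; rewrite rnE /affine; field.
Qed.

Lemma dispersion_affine mu nu m s a b : s != 0 -> b != 0 ->
  (forall A, measurable A -> nu A = mu (affine m s @^-1` A)) ->
  dispersion nu (m + s * a) (s * b) = dispersion mu a b.
Proof.
move=> s0 b0 numu; rewrite /dispersion.
have [-> ->] := cauchy_affine a s0 b0 numu.
have := cauchy_sqr_norm_gt0 mu a b0.
move: (cauchy_norm2 mu a b) (cauchy_re mu a b) => N Q NQ.
by field; rewrite s0 lt0r_neq0.
Qed.

(** The convolution identity at [c z] says that
    [V_mu (c z) = V_mu z + V_nu (c z) - 1], where [nu] is the cofactor, and the
    dispersion of [nu] is at least [1]. *)
Lemma boolean_selfdecomposable_dispersion mu (c a b : R) :
  boolean_selfdecomposable mu -> 0 < c < 1 -> 0 < b ->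
  dispersion mu a b <= dispersion mu (c * a) (c * b).
Proof.
move=> sd c01 b0; have [nu conv] := sd c c01; have /andP[c0 _] := c01.
have cb0 : 0 < c * b by rewrite mulr_gt0.
have : complex.Im (K_transform mu (c * a +i* (c * b))) =
    complex.Im (K_transform (dilation c mu) (c * a +i* (c * b))) +
    complex.Im (K_transform nu (c * a +i* (c * b))).
  by rewrite conv ?inE//; exact: raddfD.
rewrite !Im_K_transform ?lt0r_neq0// -mulrDr => /(mulfI (lt0r_neq0 cb0)).
have -> : dispersion (dilation c mu) (c * a) (c * b) = dispersion mu a b.
  rewrite -[c * a]add0r; apply: dispersion_affine; rewrite ?lt0r_neq0//.
  move=> A _; rewrite /dilation /distribution /pushforward; congr (mu _).
  by apply/seteqP; split => x; rewrite /affine/= add0r.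
have := dispersion_ge1 nu (c * a) (lt0r_neq0 cb0).
lra.
Qed.

End boolean.

(** * Dispersion for normal laws *)

Section normal.
Context {R : realType}.
Implicit Types (m s a b x : R).

Definition std_normal : borel_probability R := normal_prob 0 1.

Lemma dispersion_normal m s a b : s != 0 -> b != 0 ->
  dispersion (normal_prob m s) (m + s * a) (s * b) = dispersion std_normal a b.
Proof.
move=> s0 b0.
have numu A : measurable A ->
    normal_prob m s A = std_normal (affine m s @^-1` A).
  by move=> mA; exact: normal_prob_affine.
exact: dispersion_affine s0 b0 numu.
Qed.

Lemma std_normal_negligible1 x : std_normal.-negligible [set x].
Proof.
exists [set x]; split => //.
apply: (null_content_dominatesP _ _).1 (normal_prob_dominates 0 1) _ _ _ => //.
exact: lebesgue_measure_set1.
Qed.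

Lemma std_normal_cauchy_re0 b : b != 0 -> cauchy_re std_normal 0 b = 0.
Proof.
move=> b0.
have N1 : -1 != 0 :> R by rewrite oppr_eq0 oner_eq0.
have sym (A : set (measurableTypeR R)) : measurable A ->
    std_normal A = std_normal (affine 0 (-1) @^-1` A).
  move=> mA; transitivity (normal_prob 0 (-1) A).
    apply: eq_integral => x _; rewrite !normal_pdfE ?oner_eq0//.
    by rewrite /normal_peak /normal_fun sqrrN.
  exact: normal_prob_affine.
have [_] := cauchy_affine 0 N1 b0 sym.
rewrite mulr0 addr0 invrN1 !mulN1r => QE.
have QN : cauchy_re std_normal 0 (- b) = cauchy_re std_normal 0 b.
  by rewrite /cauchy_re /resolvent_norm2; under eq_Rintegral do rewrite sqrrN.
lra.
Qed.

(** From [a^2 <= 2 ((a - x)^2 + 1) (1 + x^2)] the integrand is at most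
    [2 x^2 (1 + x^2) / a^2].  The polynomial is absorbed by part of the Gaussian
    factor: [2 x^2 (1 + x^2) <= 72 exp (x^2 / 4)], and [exp (x^2 / 4)] times the
    standard normal density is a multiple of the density of variance [2]. *)
Lemma integral_sqr_resolvent_std_normal_le :
  exists2 C : R, 0 <= C & forall a, a != 0 ->
    \int[std_normal]_x (x ^+ 2 * resolvent_norm2 a 1 x) <= C / a ^+ 2.
Proof.
pose r := Num.sqrt 2 : R.
have r0 : r != 0 by rewrite gt_eqF// sqrtr_gt0.
exists (72 * (normal_peak 1 / normal_peak r)).
  by rewrite mulr_ge0// divr_ge0// normal_peak_ge0.
move=> a a0.
have a2 : 0 < a ^+ 2 by rewrite exprn_even_gt0.
have m1 : measurable_fun [set: measurableTypeR R]
    (fun x => x ^+ 2 * resolvent_norm2 a 1 x).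
  apply: measurable_funM; first exact: measurable_funX.
  by apply: measurable_resolvent_norm2; rewrite oner_eq0.
have i1 : std_normal.-integrable setT
    (EFin \o (fun x => x ^+ 2 * resolvent_norm2 a 1 x)).
  apply: (@prob_bounded_integrable _ _ _ (2 * (1 + a ^+ 2))) => // x.
  rewrite ger0_norm ?(mulr_ge0 (sqr_ge0 x) (resolvent_norm2_ge0 _ _ _))//.
  rewrite ler_pdivrMr ?resolvent_den_gt0 ?oner_eq0//.
  have := sqr_ge0 (a * (a - x)).
  have := sqr_ge0 (2 * a - x).
  by rewrite !expr2; nra.
rewrite -lee_fin /Rintegral fineK; last exact: integrable_fin_num.
rewrite integral_normal_prob//.
rewrite -[leRHS]mule1 -(integral_normal_pdf 0 r) -ge0_integralZl; last 4 first.
- exact: measurableT.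
- by apply/measurableT_comp => //; exact: measurable_normal_pdf.
- by move=> x _; rewrite lee_fin normal_pdf_ge0.
- by rewrite lee_fin divr_ge0 ?sqr_ge0// mulr_ge0// divr_ge0// normal_peak_ge0.
apply: ge0_le_integral => //.
- move=> x _; rewrite -EFinM lee_fin; apply: mulr_ge0.
    exact: (mulr_ge0 (sqr_ge0 x) (resolvent_norm2_ge0 _ _ _)).
  exact: normal_pdf_ge0.
- apply: emeasurable_funM; first exact: measurableT_comp.
  by apply/measurableT_comp => //; exact: measurable_normal_pdf.
- apply: emeasurable_funM => //; apply/measurableT_comp => //.
  exact: measurable_normal_pdf.
move=> x _; rewrite -!EFinM lee_fin !normal_pdfE ?oner_eq0//.
have p10 : 0 < normal_peak 1 :> R by rewrite normal_peak_gt0 ?oner_eq0.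
have pr0 : 0 < normal_peak r :> R by rewrite normal_peak_gt0.
rewrite [leRHS](_ : _ =
    72 / a ^+ 2 * normal_fun 0 r x * normal_peak 1); last first.
  by field; rewrite a0 gt_eqF.
rewrite mulrA mulrAC ler_pM2r//.
set u := x ^+ 2 / 4.
have u0 : 0 <= u by rewrite divr_ge0// sqr_ge0.
have -> : normal_fun 0 1 x = expR (- u) * expR (- u) :> R.
  by rewrite -expRD /normal_fun /u; congr expR; field.
have -> : normal_fun 0 r x = expR (- u) :> R.
  by rewrite /normal_fun /u sqr_sqrtr//; congr expR; field.
rewrite mulrA ler_pM2r ?expR_gt0// expRN ler_pdivrMr ?expR_gt0//.
have e1 := expR_ge1Dx u.
have e2 : 1 + u ^+ 2 / 2 <= expR u := expR_ge1Dxn 1 u0.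
set D := (a - x) ^+ 2 + 1 ^+ 2.
have D0 : 0 < D by rewrite resolvent_den_gt0 ?oner_eq0.
have aD : a ^+ 2 <= 2 * D * (1 + x ^+ 2).
  rewrite /D; have := sqr_ge0 ((a - x) - x); have := sqr_ge0 ((a - x) * x).
  by rewrite !expr2; nra.
have xE : x ^+ 2 * (1 + x ^+ 2) <= 36 * expR u.
  have -> : x ^+ 2 = 4 * u by rewrite /u; field.
  nra.
have key : x ^+ 2 * a ^+ 2 <= 72 * expR u * D.
  apply: (le_trans (ler_wpM2l (sqr_ge0 x) aD)).
  have := ler_wpM2r (ltW D0) xE; nra.
rewrite /resolvent_norm2 -/D ler_pdivrMr// -(ler_pM2r a2).
rewrite [leRHS](_ : _ = 72 * expR u * D)//.
by field.
Qed.

Lemma dispersion_std_normal0 b : b != 0 ->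
  dispersion std_normal 0 b = (b ^+ 2 * cauchy_norm2 std_normal 0 b)^-1.
Proof.
move=> b0; have N0 := cauchy_norm2_gt0 std_normal 0 b0.
rewrite /dispersion std_normal_cauchy_re0//.
by field; rewrite b0 lt0r_neq0.
Qed.

(** The reciprocal of [V (i b)] is the mean of [b^2 / (b^2 + x^2)], which is
    monotone in [b]; being the mean of a function that is less than [1] except at
    [0], it is also less than [1]. *)
Lemma dispersion_std_normal0_le b c : 0 < b -> b <= c ->
  dispersion std_normal 0 c <= dispersion std_normal 0 b.
Proof.
move=> b0 bc; have c0 := lt_le_trans b0 bc.
have [bn cn] := (lt0r_neq0 b0, lt0r_neq0 c0).
have posN y : y != 0 -> 0 < y ^+ 2 * cauchy_norm2 std_normal 0 y.
  by move=> y0; rewrite mulr_gt0 ?cauchy_norm2_gt0// exprn_even_gt0.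
rewrite !dispersion_std_normal0// lef_pV2 ?posrE ?posN//.
rewrite /cauchy_norm2 -!RintegralZl//; try exact: integrable_resolvent_norm2.
apply: le_Rintegral => //.
- exact: (integrableZl measurableT (b ^+ 2)
    (integrable_resolvent_norm2 std_normal 0 bn)).
- exact: (integrableZl measurableT (c ^+ 2)
    (integrable_resolvent_norm2 std_normal 0 cn)).
move=> x _; rewrite /resolvent_norm2 ler_pdivrMr ?resolvent_den_gt0//.
rewrite mulrAC ler_pdivlMr ?resolvent_den_gt0//.
have : b ^+ 2 <= c ^+ 2 by rewrite lerXn2r// nnegrE ltW.
by have := sqr_ge0 (0 - x); nra.
Qed.

Lemma dispersion_std_normal0_gt1 b : b != 0 -> 1 < dispersion std_normal 0 b.
Proof.
move=> b0; have b2 : 0 < b ^+ 2 by rewrite exprn_even_gt0.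
have N0 := cauchy_norm2_gt0 std_normal 0 b0.
rewrite dispersion_std_normal0// invf_gt1; last exact: mulr_gt0.
have [fi fE] := integral_resolvent_comb std_normal 0 1 (- b ^+ 2) 0 b0.
suff : 0 < 1 + - b ^+ 2 * cauchy_norm2 std_normal 0 b +
    0 * cauchy_re std_normal 0 b by lra.
have E x : 1 + - b ^+ 2 * resolvent_norm2 0 b x +
    0 * ((0 - x) * resolvent_norm2 0 b x) = x ^+ 2 * resolvent_norm2 0 b x.
  have := resolvent_den_gt0 0 x b0; rewrite /resolvent_norm2 sub0r => D0.
  by field; rewrite lt0r_neq0.
rewrite -fE; apply: Rintegral_gt0 => //.
  by move=> x; rewrite E mulr_ge0 ?sqr_ge0 ?resolvent_norm2_ge0.
apply: negligibleS (std_normal_negligible1 0) => x /=.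
rewrite E => /eqP; rewrite mulf_eq0 (gt_eqF (resolvent_norm2_gt0 _ _ b0)) orbF.
by rewrite sqrf_eq0 => /eqP.
Qed.

Lemma dispersion_std_normal_center : exists2 L : R,
  1 < L & forall b, 0 < b -> b <= 2 -> L <= dispersion std_normal 0 b.
Proof.
exists (dispersion std_normal 0 2); last first.
  by move=> b b0 b2; exact: dispersion_std_normal0_le.
by apply: dispersion_std_normal0_gt1; rewrite pnatr_eq0.
Qed.

(** The left-hand side is [1 + O(A^-2)], whereas the right-hand side stays away
    from [1]. *)
Lemma dispersion_std_normal_drop : exists2 A : R, 0 < A &
  forall a b, `|a| = A -> 0 < b -> b <= 2 ->
  dispersion std_normal a 1 < dispersion std_normal 0 b.
Proof.
have [L L1 nearL] := dispersion_std_normal_center.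
have [C C0 farC] := integral_sqr_resolvent_std_normal_le.
(* the last two conditions give [C / A^2 <= 1 / 4] and [4 C / A^2 < L - 1],
   because [A <= A^2] *)
have [A [A1 AC AL]] : exists A, [/\ 1 <= A, 4 * C <= A & 4 * C < (L - 1) * A].
  clear farC nearL; have d0 : 0 < L - 1 by rewrite subr_gt0.
  exists (1 + 4 * C + 4 * C / (L - 1)).
  have q0 : 0 <= 4 * C / (L - 1) by rewrite divr_ge0 ?mulr_ge0// ltW.
  have dC : 0 <= (L - 1) * C by rewrite mulr_ge0// ltW.
  have -> : (L - 1) * (1 + 4 * C + 4 * C / (L - 1)) =
      (L - 1) + 4 * ((L - 1) * C) + 4 * C by field; rewrite lt0r_neq0.
  split; lra.
exists A; first exact: lt_le_trans ltr01 A1.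
move=> a b aA b0 b2; apply: lt_le_trans (nearL b b0 b2).
have an : a != 0 by rewrite -normr_gt0 aA (lt_le_trans ltr01).
have := farC a an; have := @dispersion_le R std_normal a 1.
move: (Rintegral _ _ _) => e eV eC; clear farC nearL.
have A0 : 0 < A by lra.
have A20 : 0 < A ^+ 2 by rewrite exprn_gt0.
have AA : A <= A ^+ 2 by rewrite expr2 ler_peMr// ltW.
rewrite -real_normK ?num_real// aA in eC.
have e4 : e <= 1 / 4.
  by apply: (le_trans eC); rewrite ler_pdivrMr//; lra.
have eL : 4 * e < L - 1.
  have : 4 * (C / A ^+ 2) < L - 1.
    rewrite mulrA ltr_pdivrMr//; apply: (lt_le_trans AL).
    by rewrite ler_pM2l ?subr_gt0.
  lra.
apply: (le_lt_trans (eV (oner_neq0 R) e4)); lra.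
Qed.

End normal.

Theorem theorem4p4 (R : realType) :
  exists M : R, 0 < M /\
    forall m v : R, 0 < v -> M < `|m / Num.sqrt v| ->
      ~ boolean_selfdecomposable (normal_law m v).
Proof.
have [A A0 drop] := @dispersion_std_normal_drop R.
exists (2 * A); split; first by rewrite mulr_gt0.
move=> m v v0; rewrite /normal_law.
have : 0 < Num.sqrt v by rewrite sqrtr_gt0.
move: (Num.sqrt v) => s s0 mA sd.
(* [c] is chosen so that [c m] lies [A] standard deviations from [m], towards
   the origin; the bound [2 * A] keeps [c] above [1 / 2] *)
have [c [a [c01 c2 aA mca]]] : exists c a,
    [/\ 0 < c < 1, c^-1 <= 2, `|a| = A & c * m = m + s * a].
  clear drop sd.
  have [t mE] : exists t, m = s * t.
    by exists (m / s); rewrite mulrC divfK ?lt0r_neq0.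
  have {}mA : 2 * A < `|t|.
    by move: mA; rewrite mE mulrAC divff ?mul1r// lt0r_neq0.
  have t0 : 0 < `|t| by lra.
  have At : A / `|t| < 1 / 2 by rewrite ltr_pdivrMr//; lra.
  have At0 : 0 < A / `|t| by rewrite divr_gt0.
  exists (1 - A / `|t|), (- (A / `|t| * t)).
  split; [by apply/andP; split; lra|by rewrite invf_ple ?posrE//; lra| |].
    by rewrite normrN normrM gtr0_norm// divfK// lt0r_neq0.
  by rewrite mE; ring.
have /andP[c0 _] := c01.
have sn := lt0r_neq0 s0.
have sc0 : 0 < s / c by rewrite divr_gt0.
have := boolean_selfdecomposable_dispersion m sd c01 sc0.
have scE : c * (s / c) = s * 1 by rewrite mulr1 mulrC divfK// lt0r_neq0.
rewrite scE mca dispersion_normal ?oner_eq0//.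
have := dispersion_normal m 0 sn (invr_neq0 (lt0r_neq0 c0)).
rewrite mulr0 addr0 => ->; rewrite leNgt.
by rewrite (drop a c^-1 aA) // invr_gt0.
Qed.
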